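(* Let $G=(V,E)$ be a directed graph (a directed $2$-uniform hypergraph). Then $\Theta(G)=|V|$ if and only if $E\cup\{(v,v):v\in V\}\unrhd\{(v,v):v\in V\}$.
   Context: A directed $k$-uniform hypergraph is a pair $(V,E)$ with $V$ finite and $E$ a set of $k$-tuples of elements of $V$; for $k=2$ this is a directed graph. The strong product $G\boxtimes H$ has vertex set $V_G\times V_H$, and $((g_1,h_1),(g_2,h_2))$ is an edge iff either ($g_1=g_2$ and $(h_1,h_2)\in E_H$), or ($(g_1,g_2)\in E_G$ and $h_1=h_2$), or ($(g_1,g_2)\in E_G$ and $(h_1,h_2)\in E_H$). $G^{\boxtimes n}$ is the $n$-fold strong product. An independent set is a vertex set $S$ such that no edge has both endpoints in $S$; $\alpha$ is the maximum size of an independent set; $\Theta(G)=\lim_{n\to\infty}\alpha(G^{\boxtimes n})^{1/n}$. Combinatorial degeneration: for finite sets $I_1,I_2$ and $\Phi\subseteq\Psi\subseteq I_1\times I_2$, $\Psi\unrhd\Phi$ means there are maps $u_1:I_1\to\mathbb{Z}$, $u_2:I_2\to\mathbb{Z}$ with $u_1(x_1)+u_2(x_2)>0$ for every $(x_1,x_2)\in\Psi\setminus\Phi$ and $u_1(x_1)+u_2(x_2)=0$ for every $(x_1,x_2)\in\Phi$.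
   Formalization: The directed graph is assumed to have no loops (v,v) in E; with loops allowed the claim fails, e.g. V={v}, E={(v,v)} has Θ(G)=0≠1 although the degeneration holds trivially. *)

(* Defs.v *)
From HB Require Import structures.
From mathcomp Require Import all_boot all_order all_algebra.
From mathcomp Require Import all_classical all_reals all_analysis.

Set Implicit Arguments.
Unset Strict Implicit.
Unset Printing Implicit Defensive.

Import Order.TTheory GRing.Theory Num.Theory.
Import numFieldNormedType.Exports.

Record digraph := Digraph {
  vertex : finType;
  edges : {set vertex * vertex}
}.

(* A vertex carrying a loop lies in no independent set, whereas the degeneration
   condition only sees edges G together with all loops, so the equivalence is
   about digraphs without loops: for the one-vertex graph with a loop,
   Theta = 0 although the degeneration is trivial. *)
Definition loopless (G : digraph) : Prop :=
  forall v : vertex G, (v, v) \notin edges G.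

Definition strong_product (G H : digraph) : digraph :=
  @Digraph (vertex G * vertex H)%type
    [set e : (vertex G * vertex H) * (vertex G * vertex H) |
      let: ((g1, h1), (g2, h2)) := e in
      [|| (g1 == g2) && ((h1, h2) \in edges H),
          ((g1, g2) \in edges G) && (h1 == h2)
        | ((g1, g2) \in edges G) && ((h1, h2) \in edges H)]].

(* The one-vertex graph without edges is the unit of the strong product up to
   isomorphism, hence a legitimate 0-th power; it plays no role in the limit
   defining the Shannon capacity. *)
Definition digraph1 : digraph := @Digraph unit finset.set0.

Fixpoint strong_power (G : digraph) (n : nat) : digraph :=
  if n is n'.+1 then strong_product G (strong_power G n') else digraph1.

Definition independent (G : digraph) (S : {set vertex G}) : bool :=
  [forall e in edges G, ~~ ((e.1 \in S) && (e.2 \in S))].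

Definition alpha (G : digraph) : nat :=
  \max_(S : {set vertex G} | independent S) #|S|.

Local Open Scope classical_set_scope.
Local Open Scope ring_scope.

(* For loopless G, G |-> alpha G is supermultiplicative and
   alpha (G^n) <= #|V|^n, so the limit exists by Fekete's lemma. *)
Definition Theta (R : realType) (G : digraph) : R :=
  lim ((fun n : nat => (alpha (strong_power G n))%:R `^ (n%:R^-1) : R) @ \oo).

Definition comb_degeneration (I1 I2 : finType) (Psi Phi : {set I1 * I2}) : Prop :=
  Phi \subset Psi /\
  exists (u1 : I1 -> int) (u2 : I2 -> int),
    (forall x1 x2, (x1, x2) \in Psi :\: Phi -> 0 < u1 x1 + u2 x2) /\
    (forall x1 x2, (x1, x2) \in Phi -> u1 x1 + u2 x2 = 0).

Definition loops (V : finType) : {set V * V} :=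
  [set e : V * V | e.1 == e.2]%SET.

(* Main.v *)
Require Import Defs.
From HB Require Import structures.
From mathcomp Require Import all_boot all_order all_algebra.
From mathcomp Require Import all_classical all_reals all_analysis ring.

Set Implicit Arguments.
Unset Strict Implicit.
Unset Printing Implicit Defensive.

Import Order.TTheory GRing.Theory Num.Theory.
Import numFieldNormedType.Exports.

(** A degeneration is the same thing as an integer potential that strictly
    decreases along the edges of [G].
    If there is such a potential [u], summing it over the coordinates gives a
    potential on [G^n] with at most [n * M + 1] values; its level sets are
    independent, so [|V|^n <= (n * M + 1) * alpha (G^n)] and [Theta G = |V|].
    If there is none, some nonempty vertex set [W] has a map [s : W -> W] along
    edges.  The matrix equal to the identity except for entries [-1] at
    [(w, s w)], [w] in [W], kills the indicator vector of [W], so its rank [r]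
    is less than [|V|].  Its [n]-th Kronecker power has rank at most [r^n] and
    restricts to the identity on every independent set of [G^n], hence
    [alpha (G^n) <= (|V| - 1)^n]. *)

(** * Potentials, level sets and sinks *)

Definition decreasing_along (G : digraph) (u : vertex G -> nat) : Prop :=
  forall x y, (x, y) \in edges G -> (u y < u x)%N.

Lemma independentP (G : digraph) (S : {set vertex G}) :
  reflect (forall x y, x \in S -> y \in S -> (x, y) \notin edges G)
          (independent S).
Proof.
apply: (iffP forall_inP) => [indS x y xS yS|indS [x y] Exy].
  by apply: contraT => /negPn /indS /=; rewrite xS yS.
by apply/negP => /= /andP[xS yS]; move: (indS x y xS yS); rewrite Exy.
Qed.

Lemma leq_alpha (G : digraph) (S : {set vertex G}) :
  independent S -> (#|S| <= alpha G)%N.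
Proof. by move=> indS; rewrite /alpha (bigD1 S) //= leq_maxl. Qed.

Lemma alpha_le_card (G : digraph) : (alpha G <= #|vertex G|)%N.
Proof. by apply/bigmax_leqP => S _; exact: max_card. Qed.

Lemma card_strong_power (G : digraph) (n : nat) :
  #|vertex (strong_power G n)| = (#|vertex G| ^ n)%N.
Proof.
elim: n => [|n IHn] /=; first by rewrite card_unit.
by rewrite card_prod IHn expnS.
Qed.

(** Along an edge of a strong product each coordinate stays put or follows an edge, and at least one
    moves, so the sum of the coordinate potentials drops. *)
Lemma strong_power_potential (G : digraph) (u : vertex G -> nat) (M n : nat) :
    decreasing_along u -> (forall x, u x <= M)%N ->
  exists2 w : vertex (strong_power G n) -> nat,
    decreasing_along w & forall x, (w x <= n * M)%N.
Proof.
move=> u_dec uM; elim: n => [|n [w w_dec wM]] /=.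
  by exists (fun=> 0%N) => // x y; rewrite inE.
exists (fun x => u x.1 + w x.2)%N => [[g h] [g' h']|[g h]] /=.
  rewrite inE /= => /or3P[] /andP[].
  - by move=> /eqP -> /w_dec; rewrite ltn_add2l.
  - by move=> /u_dec + /eqP ->; rewrite ltn_add2r.
  - by move=> /u_dec ugg' /w_dec /ltnW whh'; rewrite -addSn leq_add.
by rewrite mulSn leq_add.
Qed.

(** No edge joins two vertices of equal potential, so each of the [M.+1] levels is independent. *)
Lemma card_le_levels_alpha (G : digraph) (u : vertex G -> nat) (M : nat) :
    decreasing_along u -> (forall x, u x <= M)%N ->
  (#|vertex G| <= M.+1 * alpha G)%N.
Proof.
move=> u_dec uM.
rewrite -sum1_card.
rewrite (partition_big (fun x => inord (u x) : 'I_M.+1) predT) //=.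
rewrite -[X in (_ <= X * _)%N](card_ord M.+1) -sum_nat_const.
apply: leq_sum => i _; rewrite sum1dep_card; apply: leq_alpha.
apply/independentP => x y; rewrite !inE => /eqP xi /eqP yi.
apply/negP => /u_dec; rewrite -(@inordK M (u x)) ?ltnS //.
by rewrite -(@inordK M (u y)) ?ltnS // xi yi ltnn.
Qed.

(* Either every nonempty set has a sink, and then removing sinks one at a time
   builds the potential, or some nonempty set has none. *)
Lemma potential_or_sinkless (G : digraph) :
  (exists u : vertex G -> nat, decreasing_along u) \/
  (exists2 W : {set vertex G}, W != finset.set0 &
    forall w, w \in W -> exists2 w', w' \in W & (w, w') \in edges G).
Proof.
have [|noW] := pselect (exists2 W : {set vertex G}, W != finset.set0 &
    forall w, w \in W -> exists2 w', w' \in W & (w, w') \in edges G).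
  by right.
left; suff main (D : {set vertex G}) : exists u : vertex G -> nat, forall x y,
    x \in D -> y \in D -> (x, y) \in edges G -> (u y < u x)%N.
  have [u uP] := main [set: vertex G]%SET.
  by exists u => x y; apply: uP; rewrite inE.
have [m] := ubnP #|D|; elim: m D => // m IHm D; rewrite ltnS => leDm.
have [->|D0] := eqVneq D finset.set0.
  by exists (fun=> 0%N) => x y; rewrite inE.
have [w wD w_sink] : exists2 w, w \in D &
    forall w', w' \in D -> (w, w') \notin edges G.
  apply: contrapT => noS; apply: noW; exists D => // w wD.
  apply: contrapT => now; apply: noS; exists w => // w' w'D.
  by apply/negP => Eww'; apply: now; exists w'.
have [|u uP] := IHm (D :\ w)%SET.
  by move: leDm; rewrite (cardsD1 w) wD.
(* The sink [w] goes to the bottom; lifting the rest by one makes the edges into [w] decrease as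
   well. *)
exists (fun x => if x == w then 0%N else (u x).+1) => x y xD yD Exy.
have xw : x != w by apply: contraTneq Exy => ->; exact: w_sink.
rewrite (negPf xw); case: (eqVneq y w) => // yw.
by rewrite ltnS; apply: uP; rewrite // !inE ?xw ?yw.
Qed.

(** * Rank bounds for independent sets *)

Local Open Scope ring_scope.

(* A factorization [B *m C], with inner index set [I], of a matrix indexed by
   the vertices that has [1] on the diagonal and [0] off the edges. *)
Definition fitting_factorization (F : nzRingType) (G : digraph) (I : finType)
    (b c : vertex G -> I -> F) : Prop :=
  (forall x, \sum_i b x i * c x i = 1) /\
  (forall x y, x != y -> (x, y) \notin edges G -> \sum_i b x i * c y i = 0).

(** On an independent set [S] the factored matrix restricts to the identity, which cannot factor
    through fewer than [#|S|] indices. *)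
Lemma alpha_le_factorization (F : comNzRingType) (G : digraph) (I : finType)
    (b c : vertex G -> I -> F) :
  fitting_factorization b c -> (alpha G <= #|I|)%N.
Proof.
move=> [bc1 bc0]; apply/bigmax_leqP => S /independentP indS.
pose B := \matrix_(i < #|S|, j < #|I|) b (enum_val i) (enum_val j).
pose C := \matrix_(j < #|I|, i < #|S|) c (enum_val i) (enum_val j).
apply: (@mulmx1_min _ _ _ B C); apply/matrixP => i k; rewrite !mxE.
under eq_bigr do rewrite !mxE.
rewrite -(reindex enum_val (onW_bij _ (@enum_val_bij I))
  (op := +%R) (P := predT) (F := fun j => b (enum_val i) j * c (enum_val k) j)) /=.
have [->|ik] := eqVneq i k; first exact: bc1.
by apply: bc0; rewrite ?(inj_eq enum_val_inj) // indS ?enum_valP.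
Qed.

(** Entries of a Kronecker product multiply. If two distinct vertices form no edge, then in some
    coordinate they are distinct and form no edge, and that factor is zero. *)
Lemma fitting_factorizationM (F : comNzRingType) (G H : digraph)
    (I J : finType) (b c : vertex G -> I -> F) (b' c' : vertex H -> J -> F) :
  fitting_factorization b c -> fitting_factorization b' c' ->
  @fitting_factorization F (strong_product G H) (I * J)%type
    (fun x ij => b x.1 ij.1 * b' x.2 ij.2)
    (fun x ij => c x.1 ij.1 * c' x.2 ij.2).
Proof.
move=> [bc1 bc0] [bc1' bc0'].
have sumM g h g' h' : \sum_(ij : I * J) b g ij.1 * b' h ij.2 *
      (c g' ij.1 * c' h' ij.2) =
    (\sum_i b g i * c g' i) * (\sum_j b' h j * c' h' j).
  rewrite big_distrlr pair_big /=.
  by apply: eq_bigr => -[i j] _ /=; rewrite mulrACA.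
split=> [x|[g h] [g' h']]; first by rewrite sumM bc1 bc1' mulr1.
rewrite inE /= sumM xpair_eqE => neq nE.
have [Eg|ng] := eqVneq g g'; last first.
  have [Egg'|/(bc0 _ _ ng) ->] := boolP ((g, g') \in edges G); last first.
    by rewrite mul0r.
  move: nE; rewrite Egg' /= !negb_or => /and3P[_ nh nE].
  by rewrite (bc0' _ _ nh nE) mulr0.
move: neq nE; rewrite Eg eqxx /= negb_or => nh /andP[nE _].
by rewrite (bc0' _ _ nh nE) mulr0.
Qed.

Lemma strong_power_factorization (F : comNzRingType) (G : digraph)
    (I : finType) (b c : vertex G -> I -> F) (n : nat) :
  fitting_factorization b c ->
  exists (J : finType) (b' c' : vertex (strong_power G n) -> J -> F),
    #|J| = (#|I| ^ n)%N /\ fitting_factorization b' c'.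
Proof.
move=> bcP; elim: n => [|n [J [b' [c' [cardJ bcP']]]]].
  exists unit, (fun _ _ => 1), (fun _ _ => 1); rewrite card_unit; split=> //.
  by split=> [x|[] []//]; rewrite sumr_const card_unit mulr1.
exists (I * J)%type; do 2!eexists; split; first by rewrite card_prod cardJ expnS.
exact: fitting_factorizationM bcP bcP'.
Qed.

Lemma alpha_strong_power_le (F : comNzRingType) (G : digraph) (I : finType)
    (b c : vertex G -> I -> F) (n : nat) :
  fitting_factorization b c -> (alpha (strong_power G n) <= #|I| ^ n)%N.
Proof.
move=> /(strong_power_factorization n)[J [b' [c' [<- bcP]]]].
exact: alpha_le_factorization bcP.
Qed.

(** [r] is the rank of the identity minus the matrix of [s] on [W]. As [G] is loopless, [s] has no
    fixed point in [W], so the diagonal stays 1. *)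
Lemma sinkless_factorization (F : fieldType) (G : digraph)
    (W : {set vertex G}) :
    loopless G -> W != finset.set0 ->
    (forall w, w \in W -> exists2 w', w' \in W & (w, w') \in edges G) ->
  exists r, (r < #|vertex G|)%N /\
    exists b c : vertex G -> 'I_r -> F, fitting_factorization b c.
Proof.
move=> loopG W0 Wsucc.
have {Wsucc} /choice[s sP] w : exists w',
    w \in W -> w' \in W /\ (w, w') \in edges G.
  have [/Wsucc[w' ? ?]|] := boolP (w \in W); first by exists w'.
  by exists w.
pose a (x y : vertex G) : F := (x == y)%:R - ((x \in W) && (y == s x))%:R.
pose A := \matrix_(i < #|vertex G|, j < #|vertex G|)
  a (enum_val i) (enum_val j).
pose v := \col_(j < #|vertex G|) (enum_val j \in W)%:R : 'cV[F]_(#|vertex G|).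
have Av : A *m v = 0.
  apply/matrixP => i j; rewrite !mxE.
  under eq_bigr do rewrite !mxE.
  rewrite -(reindex enum_val (onW_bij _ (@enum_val_bij (vertex G)))
    (op := +%R) (P := predT) (F := fun y => a (enum_val i) y * (y \in W)%:R)) /=.
  set x := enum_val i.
  under eq_bigr do rewrite mulrBl.
  rewrite big_split sumrN /= (bigD1 x) //= eqxx mul1r big1 ?addr0; last first.
    by move=> y /negPf yx; rewrite eq_sym yx mul0r.
  rewrite (bigD1 (s x)) //= eqxx big1 ?addr0; last first.
    by move=> y /negPf yx; rewrite yx andbF mul0r.
  have [xW|] := boolP (x \in W); last by rewrite mul0r subr0.
  by rewrite (sP x xW).1 mul1r subrr.
have rA : (\rank A < #|vertex G|)%N.
  rewrite ltn_neqAle rank_leq_row andbT; apply/negP => /eqP fullA.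
  (* Full rank would make [A] invertible, and [Av] would force [v = 0] although [W] is nonempty. *)
  have /mulKmx/(_ v) : A \in unitmx by rewrite -row_full_unit /row_full fullA.
  rewrite Av mulmx0 => v0; have /set0Pn[w wW] := W0.
  have /matrixP/(_ (enum_rank w) 0) := v0.
  by rewrite !mxE enum_rankK wW => /esym/eqP; rewrite oner_eq0.
exists (\rank A); split=> //.
exists (fun x i => col_base A (enum_rank x) i).
exists (fun x i => row_base A i (enum_rank x)).
have sumE x y : \sum_i col_base A (enum_rank x) i * row_base A i (enum_rank y)
    = a x y.
  have /matrixP/(_ (enum_rank x) (enum_rank y)) := mulmx_base A.
  by rewrite !mxE !enum_rankK.
split=> [x|x y xy nE]; rewrite sumE /a.
  rewrite eqxx; case: (boolP (x \in W)) => xW /=; last by rewrite subr0.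
  case: eqP => [xs|]; last by rewrite subr0.
  by have [_] := sP x xW; rewrite -xs (negPf (loopG x)).
rewrite (negPf xy) sub0r; case: (boolP (x \in W)) => xW /=; last by rewrite oppr0.
case: eqP => [ys|]; last by rewrite oppr0.
by have [_] := sP x xW; rewrite -ys (negPf nE).
Qed.

(** * Degenerations as potentials *)

(** The equations on the loops say [u2 = - u1], so positivity on an edge [(x, y)] means
    [u1 y < u1 x]. *)
Lemma comb_degeneration_loopsP (G : digraph) : loopless G ->
  comb_degeneration (edges G :|: loops (vertex G))%SET (loops (vertex G)) <->
  exists u : vertex G -> nat, decreasing_along u.
Proof.
move=> loopG; split=> [[_ [u1 [u2 [upos u0]]]]|[u u_dec]].
  (* [m] bounds every [|u1 x|], so adding it to [u1] gives natural values. *)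
  pose m := (\sum_x `|u1 x|)%N.
  have m_ge x : 0 <= u1 x + m%:Z.
    rewrite /m (bigD1 x) //= PoszD addrA; apply: addr_ge0 => //.
    by rewrite abszE -lerBlDl sub0r -normrN ler_norm.
  exists (fun x => absz (u1 x + m%:Z)) => x y Exy.
  rewrite -ltz_nat !gez0_abs // ltrD2r.
  have xy : x != y by apply: contraTneq Exy => ->; exact: loopG.
  have := upos x y; rewrite !inE /= (negPf xy) Exy => /(_ isT).
  have := u0 y y; rewrite inE eqxx => /(_ isT)/eqP; rewrite addr_eq0 => /eqP ->.
  by rewrite -[- _ < _]subr_gt0 opprK.
split; first exact: finset.subsetUr.
exists (fun x => (u x)%:Z), (fun x => - (u x)%:Z); split=> x y; rewrite !inE /=.
  by case: (x == y) => //=; rewrite orbF => /u_dec uyx; rewrite subr_gt0 ltz_nat.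
by move=> /eqP ->; rewrite subrr.
Qed.

(** * Roots, limits and the capacity *)

Lemma root_exprn (R : realType) (a : R) (n : nat) :
  0 <= a -> (a ^+ n.+1) `^ (n.+1%:R^-1) = a.
Proof.
by move=> a0; rewrite -powR_mulrn // -powRrM mulfV ?pnatr_eq0 // powRr1.
Qed.

Local Open Scope classical_set_scope.

(** By [ln x <= 2 * sqrt x], the logarithm of the term is at most [2 * sqrt K / sqrt n.+1], which
    tends to 0. *)
Lemma cvg_root_linear (R : realType) (K : nat) : (0 < K)%N ->
  (fun n : nat => (n.+1 * K)%:R `^ (n.+1%:R^-1) : R) @ \oo --> (1 : R).
Proof.
move=> K0.
pose h n : R := expR (2 * Num.sqrt K%:R * Num.sqrt (harmonic n)).
apply: (@squeeze_cvgr _ _ _ _ (fun=> 1) h); last 2 first.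
- exact: cvg_cst.
- rewrite -[1]expR0 /h; apply: continuous_cvg; first exact: continuous_expR.
  rewrite -[0](mulr0 (2 * Num.sqrt K%:R)); apply: cvgMl_tmp.
  rewrite -[0]sqrtr0; apply: continuous_cvg.
    exact: sqrt_continuous.
  exact: cvg_harmonic.
near=> n.
have nK_ge1 : 1 <= (n.+1 * K)%:R :> R by rewrite ler1n muln_gt0.
have nK_gt0 : 0 < (n.+1 * K)%:R :> R by exact: lt_le_trans nK_ge1.
rewrite -{1}(powRr0 (n.+1 * K)%:R) ler_powR ?invr_ge0 //=.
rewrite /powR gt_eqF // ler_expR.
(* With [s = sqrt x], this is [ln x = 2 * ln s] and [ln s <= s - 1]. *)
have ln_le : ln (n.+1 * K)%:R <= 2 * Num.sqrt (n.+1 * K)%:R :> R.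
  rewrite -{1}(sqr_sqrtr (ltW nK_gt0)) lnXn ?sqrtr_gt0 //.
  rewrite -[ln _ *+ 2]mulr_natl ler_pM2l //.
  apply: le_trans (_ : Num.sqrt (n.+1 * K)%:R - 1 <= _); last first.
    by rewrite lerBlDr lerDl.
  set s := Num.sqrt _; rewrite -{1}(subrKC 1 s) le_ln1Dx // ltrBrDr addNr.
  by rewrite sqrtr_gt0.
apply: le_trans (ler_wpM2l _ ln_le) _; first by rewrite invr_ge0.
rewrite /harmonic sqrtrV // natrM sqrtrM //.
rewrite -{1}[n.+1%:R](@sqr_sqrtr R) // expr2 invfM.
have sn0 : Num.sqrt n.+1%:R != 0 :> R by rewrite gt_eqF // sqrtr_gt0.
rewrite le_eqVlt; apply/orP; left; apply/eqP; field.
Unshelve. all: by end_near. Qed.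

Lemma Theta_le (R : realType) (G : digraph) (a : nat) :
  (forall n, alpha (strong_power G n) <= a ^ n)%N -> Theta R G <= a%:R.
Proof.
move=> alpha_le; rewrite /Theta; set f := (f in lim (f @ _)).
(* [lim] of a divergent sequence is the junk value [point], which is [0]. *)
have [cvgf|/dvgP -> //] := pselect (cvg (f @ \oo)).
(* Index 0 is skipped: since [0^-1 = 0], that term equals 1, which exceeds the bound when
   [a = 0]. *)
apply: limr_le => //; exists 1%N => // -[//|n] _ /=.
rewrite /f -[leRHS](root_exprn n) //.
by apply: ge0_ler_powR; rewrite ?nnegrE // -natrX ler_nat.
Qed.

(** Counting levels in the powers squeezes the term of index [n.+1] between [|V| / r n] and [|V|],
    and [r n] tends to 1. *)
Lemma Theta_potential (R : realType) (G : digraph) (u : vertex G -> nat) :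
  decreasing_along u -> Theta R G = #|vertex G|%:R.
Proof.
move=> u_dec; apply: cvg_lim => //; rewrite -cvg_shiftS /=.
pose M := (\max_x u x)%N.
have uM x : (u x <= M)%N by exact: leq_bigmax.
(* The level count [n.+1 * M + 1] is rounded up to [n.+1 * M.+1] before taking the root. *)
pose r n : R := (n.+1 * M.+1)%:R `^ (n.+1%:R^-1).
apply: (@squeeze_cvgr _ _ _ _ (fun n => #|vertex G|%:R / r n)
  (fun=> #|vertex G|%:R)); last 2 first.
- rewrite -[X in _ --> X]divr1; apply: cvgMl_tmp; apply: cvgV; first by [].
  exact: cvg_root_linear.
- exact: cvg_cst.
near=> n.
have r0 : 0 < r n by rewrite powR_gt0.
apply/andP; split; last first.
  rewrite -[leRHS](root_exprn n) //.
  apply: ge0_ler_powR; rewrite ?nnegrE // -natrX ler_nat -card_strong_power.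
  exact: alpha_le_card.
rewrite ler_pdivrMr // /r -powRM // -natrM -{1}(root_exprn n (ler0n R _)).
apply: ge0_ler_powR; rewrite ?nnegrE // -natrX ler_nat.
have [w w_dec wM] := strong_power_potential n.+1 u_dec uM.
rewrite -card_strong_power mulnC.
apply: leq_trans (card_le_levels_alpha w_dec wM) _.
by rewrite leq_mul2r mulnS -[in X in _ || X]add1n leq_add2r orbT.
Unshelve. all: by end_near. Qed.

Local Close Scope classical_set_scope.

Theorem theorem2p23 (R : realType) (G : digraph) (hG : loopless G) :
  Theta R G = #|vertex G|%:R <->
  comb_degeneration (edges G :|: loops (vertex G)) (loops (vertex G)).
Proof.
rewrite (comb_degeneration_loopsP hG); split=> [ThetaV|[u]]; last first.
  exact: Theta_potential.
have [//|[W W0 Wsucc]] := potential_or_sinkless G.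
have [r [rV [b [c bcP]]]] := @sinkless_factorization rat G W hG W0 Wsucc.
have /(Theta_le R) : forall n, (alpha (strong_power G n) <= r ^ n)%N.
  by move=> n; rewrite -{1}(card_ord r); exact: alpha_strong_power_le bcP.
by rewrite ThetaV ler_nat leqNgt rV.
Qed.
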